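(* Let $\Sigma:\ \dot x=f(x)+\sum_{i=1}^p g_i(x)u_i$ be an input-affine system with $C^\infty$ vector fields on an open set $\mathcal{X}\subset\mathbb{R}^n$, with a flat output $y=h(x)\in\mathbb{R}^p$ ($h$ of class $C^\infty$). Let $\ell\in\mathbb{N}_0^p$ be such that $y$ is also a flat output for the prolonged system $\Sigma^{(\ell)}$, and let $(\mathcal{A}_i,\mathcal{O}_i)$ and $(\mathcal{A}_j,\mathcal{O}_j)$ be two elements of the $\ell$-realizable family $\mathcal{N}^\ell_{(\Sigma,y)}$. Assume that the associated flat outputs $y_{\overline{\mathcal{O}_i},\mathcal{A}_i}$ and $y_{\overline{\mathcal{O}_j},\mathcal{A}_j}$ of $\Sigma^{(\ell)}$ are compatible. Then, under the same exact-linearizing controller for $\Sigma^{(\ell)}$, a switch from regulating $y_{\overline{\mathcal{O}_i},\mathcal{A}_i}$ to regulating $y_{\overline{\mathcal{O}_j},\mathcal{A}_j}$ preserves the exponentially stable error dynamics of the shared components, i.e. produces no transient on the components common to both selections. Explicitly: suppose the controller regulates $y_{\overline{\mathcal{O}_i},\mathcal{A}_i}$ before a switching time $t_s$ and $y_{\overline{\mathcal{O}_j},\mathcal{A}_j}$ from $t_s$ on, with the state of $\Sigma^{(\ell)}$ lying in the validity set of the active output and, at $t_s$, in the intersection of the two validity sets. Then for every shared component (that is, $y_k$ with $k\in\overline{\mathcal{O}_i}\cap\overline{\mathcal{O}_j}$, or $u_k$ with $k\in\mathcal{A}_i\cap\mathcal{A}_j$) the tracking error of that component satisfies one and the same exponentially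 stable linear time-invariant differential equation (the one assigned by the gains of that channel) both before and after $t_s$.
   Context: **Vector relative degree, flat output, validity set.** For a smooth input-affine system $\dot\xi=F(\xi)+\sum_{j=1}^m G_j(\xi)v_j$ on an open set of $\mathbb{R}^N$ with smooth output $z_i=H_i(\xi)$, $i=1,\dots,m$, the vector relative degree at $\xi^\circ$ is $r=(r_1,\dots,r_m)$, $r_i\ge1$, if $L_{G_j}L_F^kH_i\equiv0$ near $\xi^\circ$ for all $j$ and $0\le k<r_i-1$, and the decoupling matrix $[L_{G_j}L_F^{r_i-1}H_i]_{i,j}$ is nonsingular at $\xi^\circ$. The output is *flat* if at some $\xi^\circ$ it has a vector relative degree with $\sum_i r_i=N$. The *validity set* is the set of points where the vector relative degree is well defined and equal to that at $\xi^\circ$ and the decoupling matrix is nonsingular. Two flat outputs of the same system are *compatible* if there is a nonempty open set contained in the intersection of their validity sets. **Prolongation.** For $\ell=(l_1,\dots,l_p)\in\mathbb{N}_0^p$, $\Sigma^{(\ell)}$ is $\Sigma$ with a chain of $l_i$ integrators on each input: $u_i^{(l_i)}=v_i$. Its input is $v=(v_1,\dots,v_p)$ and its state $x_\ell$ consists of $x$ and $u_i,\dots,u_i^{(l_i-1)}$, $i=1,\dots,p$. The state dimension is $n+\sum_i l_i$. If $l_i=0$ then $u_i=v_i$. **$\ell$-realizable family.** Let $\mathcal{I}=\{1,\dots,p\}$, $\overline{\mathcal{S}}=\mathcal{I}\setminus\mathcal{S}$, and let $q_{\mathcal{S}}$ denote the subvector with indices in $\mathcal{S}$. For $\mathcal{A},\mathcal{O}\subset\mathcal{I}$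 with $|\mathcal{A}|=|\mathcal{O}|$ put $y_{\overline{\mathcal{O}},\mathcal{A}}=[\,y_{\overline{\mathcal{O}}}^\top\ \ u_{\mathcal{A}}^\top\,]^\top\in\mathbb{R}^p$, viewed as an output of $\Sigma^{(\ell)}$. The component $u_k$ has relative degree $l_k$ in $\Sigma^{(\ell)}$ ($l_k=0$ being allowed as direct feedthrough) and its decoupling row is the unit row selecting $v_k$. Then $\mathcal{N}^\ell_{(\Sigma,y)}$ is the set of pairs $(\mathcal{A},\mathcal{O})$ with $|\mathcal{A}|=|\mathcal{O}|$ such that $y_{\overline{\mathcal{O}},\mathcal{A}}$ is a flat output for $\Sigma^{(\ell)}$. It contains $(\emptyset,\emptyset)$, which corresponds to $y$ itself. **The exact-linearizing controller for $\Sigma^{(\ell)}$.** Let $r=(r_1,\dots,r_p)$ be the vector relative degree of $y$ for $\Sigma^{(\ell)}$, and write $(y_1^{(r_1)},\dots,y_p^{(r_p)})^\top=b(x_\ell)+A(x_\ell)v$. Put $q(x_\ell)=\begin{bmatrix}b(x_\ell)\\0_p\end{bmatrix}\in\mathbb{R}^{2p}$ and $D(x_\ell)=\begin{bmatrix}A(x_\ell)\\ I_p\end{bmatrix}\in\mathbb{R}^{2p\times p}$. Let sufficiently smooth references $y_k^d(t),u_k^d(t)$ be given, with errors $e_{y,k}=y_k^d-y_k$ and $e_{u,k}=u_k^d-u_k$. Choose gains such that the polynomials $\lambda^{r_k}+k_{y,k}^{(r_k-1)}\lambda^{r_k-1}+\cdots+k_{y,k}^0$ and $\lambda^{l_k}+k_{u,k}^{(l_k-1)}\lambda^{l_k-1}+\cdots+k_{u,k}^0$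 are Hurwitz. Let $w\in\mathbb{R}^{2p}$ have entries $w_k=(y_k^d)^{(r_k)}+\sum_{s=0}^{r_k-1}k_{y,k}^{s}e_{y,k}^{(s)}$ and $w_{p+k}=(u_k^d)^{(l_k)}+\sum_{s=0}^{l_k-1}k_{u,k}^{s}e_{u,k}^{(s)}$ for $k=1,\dots,p$ (the sum is empty if $l_k=0$). For a pair $(\mathcal{A},\mathcal{O})\in\mathcal{N}^\ell_{(\Sigma,y)}$ let $\Gamma\in\{0,1\}^{p\times 2p}$ be the matrix selecting the rows with indices $k\in\overline{\mathcal{O}}$ and $p+k$, $k\in\mathcal{A}$. ''Regulating $y_{\overline{\mathcal{O}},\mathcal{A}}$'' means applying $$v=\big(\Gamma D(x_\ell)\big)^{-1}\big[-\Gamma q(x_\ell)+\Gamma w\big]$$ with the same references and gains for all selections. The error dynamics assigned to channel $y_k$ is $e_{y,k}^{(r_k)}+k_{y,k}^{(r_k-1)}e_{y,k}^{(r_k-1)}+\cdots+k_{y,k}^0e_{y,k}=0$, and that assigned to channel $u_k$ is $e_{u,k}^{(l_k)}+k_{u,k}^{(l_k-1)}e_{u,k}^{(l_k-1)}+\cdots+k_{u,k}^0e_{u,k}=0$ (for $l_k=0$: $e_{u,k}=0$). *)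

(* Defs.v *)
From HB Require Import structures.
From mathcomp Require Import all_boot all_order all_algebra.
From mathcomp Require Import complex.
From mathcomp Require Import all_classical all_reals all_analysis.

Set Implicit Arguments.
Unset Strict Implicit.
Unset Printing Implicit Defensive.

Import Order.TTheory GRing.Theory Num.Theory.
Import numFieldNormedType.Exports.

Local Open Scope ring_scope.
Local Open Scope classical_set_scope.

Section Smoothness.
Context {R : realType} {V W : normedModType R}.

(* f is C^(k+1) iff it is Frechet differentiable and its derivative is C^k.
   It is used for finite-dimensional V only, where the derivative is C^k iff
   all the directional derivatives 'D_v f are. *)
Fixpoint Ck_on (k : nat) (U : set V) (f : V -> W) : Prop :=
  if k is k'.+1 then
    (forall x, U x -> differentiable f x) /\
    (forall v : V, Ck_on k' U ('D_v f))
  else forall x, U x -> {for x, continuous f}.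

Definition smooth_on (U : set V) (f : V -> W) : Prop := forall k, Ck_on k U f.

End Smoothness.

Section AffineSystems.
Context {R : realType}.

Record affine_system (N m : nat) := AffineSystem {
  sdom : set 'cV[R]_N ;
  drift : 'cV[R]_N -> 'cV[R]_N ;
  ctrl : 'I_m -> 'cV[R]_N -> 'cV[R]_N }.

Definition smooth_system N m (S : affine_system N m) : Prop :=
  [/\ open (sdom S),
      smooth_on (sdom S) (drift S) &
      forall j, smooth_on (sdom S) (ctrl S j)].

Definition dynamics N m (S : affine_system N m) (x : 'cV[R]_N) (v : 'cV[R]_m)
    : 'cV[R]_N :=
  drift S x + \sum_(j < m) v j 0 *: ctrl S j x.

(* The output z_i = H_i(x) + \sum_j K_ij(x) v_j.  The feedthrough K is needed
   for an input channel without integrator, whose relative degree is 0. *)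
Record output (N m q : nat) := Output {
  omap : 'I_q -> 'cV[R]_N -> R ;
  ofeed : 'I_q -> 'I_m -> 'cV[R]_N -> R }.

Definition state_output N m q (h : 'cV[R]_N -> 'cV[R]_q) : output N m q :=
  Output (fun i x => h x i 0) (fun _ _ _ => 0).

Definition lie N (F : 'cV[R]_N -> 'cV[R]_N) (H : 'cV[R]_N -> R)
    : 'cV[R]_N -> R :=
  fun x => 'D_(F x) H x.

Definition lie_iter N (F : 'cV[R]_N -> 'cV[R]_N) (k : nat) (H : 'cV[R]_N -> R)
    : 'cV[R]_N -> R :=
  iter k (lie F) H.

(* The coefficient of v_j in the s-th time derivative of z_i: the feedthrough
   K_ij if s = 0, and L_{G_j} L_F^(s-1) H_i if s >= 1. *)
Definition input_coef N m q (S : affine_system N m) (z : output N m q)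
    (s : nat) (i : 'I_q) (j : 'I_m) : 'cV[R]_N -> R :=
  if s is s'.+1 then lie (ctrl S j) (lie_iter (drift S) s' (omap z i))
  else ofeed z i j.

Definition decoupling N m (S : affine_system N m) (z : output N m m)
    (r : 'I_m -> nat) (x : 'cV[R]_N) : 'M[R]_m :=
  \matrix_(i < m, j < m) input_coef S z (r i) i j x.

(* With zero feedthrough, r i = 0 would give a zero row of the decoupling
   matrix; so r i >= 1 holds automatically for such a component. *)
Definition has_relative_degree N m (S : affine_system N m) (z : output N m m)
    (r : 'I_m -> nat) (x0 : 'cV[R]_N) : Prop :=
  [/\ sdom S x0,
      forall i j s, (s < r i)%N -> \forall x \near x0, input_coef S z s i j x = 0
    & decoupling S z r x0 \in unitmx].

Definition flat_with N m (S : affine_system N m) (z : output N m m)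
    (r : 'I_m -> nat) : Prop :=
  (exists x0, has_relative_degree S z r x0) /\ (\sum_(i < m) r i)%N = N.

Definition flat_output N m (S : affine_system N m) (z : output N m m) : Prop :=
  exists r, flat_with S z r.

Definition validity_set N m (S : affine_system N m) (z : output N m m)
    (r : 'I_m -> nat) : set 'cV[R]_N :=
  [set x | has_relative_degree S z r x].

Definition compatible N m (S : affine_system N m) (z1 z2 : output N m m)
    (r1 r2 : 'I_m -> nat) : Prop :=
  exists U : set 'cV[R]_N,
    [/\ open U, U !=set0 & U `<=` validity_set S z1 r1 `&` validity_set S z2 r2].

End AffineSystems.

Definition pdim (n p : nat) (ell : 'I_p -> nat) : nat :=
  (n + \sum_(k < p) ell k)%N.

Section Prolongation.
Context {R : realType} {n p : nat}.
Variables (S : @affine_system R n p) (h : 'cV[R]_n -> 'cV[R]_p).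
Variable (ell : 'I_p -> nat).

(* tagnat.Rank and tagnat.sig1, tagnat.sig2 identify 'I_(\sum_k ell k) with the
   pairs (k, s), s < ell k; the coordinate (k, s) is u_k^(s).
   chain x k s is u_k^(s) for s < ell k, and 0 otherwise. *)
Definition chain (x : 'cV[R]_(pdim n ell)) (k : 'I_p) (s : nat) : R :=
  if insub s is Some j then dsubmx x (tagnat.Rank k (j : 'I_(ell k))) 0 else 0.

Definition prolongation : @affine_system R (pdim n ell) p := {|
  sdom := [set x | sdom S (usubmx x)] ;
  drift := fun x => col_mx
    (drift S (usubmx x) + \sum_(k < p) chain x k 0 *: ctrl S k (usubmx x))
    (\col_a chain x (tagnat.sig1 a) (tagnat.sig2 a).+1) ;
  ctrl := fun k x => col_mx
    (if ell k == 0%N then ctrl S k (usubmx x) else 0)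
    (\col_a ((tagnat.sig1 a == k) && ((tagnat.sig2 a).+1 == ell k))%:R) |}.

Definition prolonged_y : output (pdim n ell) p p :=
  state_output p (fun x : 'cV[R]_(pdim n ell) => h (usubmx x)).

(* The 2p channels (y_1, ..., y_p, u_1, ..., u_p). *)
Definition all_channels : output (pdim n ell) p (p + p) := {|
  omap := fun c x => match fintype.split c with
    | inl k => h (usubmx x) k 0
    | inr k => chain x k 0 end ;
  ofeed := fun c j x => match fintype.split c with
    | inl _ => 0
    | inr k => ((ell k == 0%N) && (j == k))%:R end |}.

(* The a-th entry of [y_(~: O); u_A] is the channel number channel A O a of
   all_channels; the default value of nth is irrelevant when #|A| = #|O|. *)
Definition channel (A O : {set 'I_p}) (a : 'I_p) : 'I_(p + p) :=
  nth (lshift p a)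
    ([seq lshift p k | k <- enum (~: O)%SET] ++ [seq rshift p k | k <- enum A])
    a.

Definition selected_output (A O : {set 'I_p}) : output (pdim n ell) p p := {|
  omap := fun a => omap all_channels (channel A O a) ;
  ofeed := fun a => ofeed all_channels (channel A O a) |}.

Definition realizable_family : set ({set 'I_p} * {set 'I_p}) :=
  [set AO : {set 'I_p} * {set 'I_p} | #|AO.1| = #|AO.2| /\
            flat_output prolongation (selected_output AO.1 AO.2)].

(* The component y_k, resp. u_k, of selected_output A O has the relative degree
   r_k, resp. ell_k, with which the controller is built; the validity set refers
   to these degrees.  The degrees of a flat output may differ from one point to
   another, and the controller is meaningless where they are not these ones. *)
Definition selected_degree (r : 'I_p -> nat) (A O : {set 'I_p}) (a : 'I_p)
    : nat :=
  match fintype.split (channel A O a) with inl k => r k | inr k => ell k end.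

Definition selected_validity_set (r : 'I_p -> nat) (A O : {set 'I_p})
    : set 'cV[R]_(pdim n ell) :=
  validity_set prolongation (selected_output A O) (selected_degree r A O).

End Prolongation.

Arguments selected_validity_set {R n p} S h ell r A O _.

Section LinearODE.
Context {R : realType}.

(* e^(d) + c_(d-1) e^(d-1) + ... + c_0 e = 0 on J; for d = 0, e = 0 on J. *)
Definition lti_solution (d : nat) (c : nat -> R) (J : set R) (e : R -> R)
    : Prop :=
  forall t, J t ->
    (forall s, (s < d)%N -> derivable (derive1n s e) t 1) /\
    derive1n d e t + \sum_(s < d) c s * derive1n s e t = 0.

Definition exponentially_stable (d : nat) (c : nat -> R) : Prop :=
  exists C alpha : R, 0 < alpha /\
    forall (J : set R) (e : R -> R),
      open J -> is_interval J -> lti_solution d c J e ->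
      forall t0 t, J t0 -> J t -> t0 <= t -> forall s, (s < d)%N ->
        `|derive1n s e t| <=
          C * expR (- alpha * (t - t0)) * \sum_(i < d) `|derive1n i e t0|.

Definition Hurwitz (q : {poly R}) : Prop :=
  forall z : R[i], root (map_poly (real_complex R) q) z -> complex.Re z < 0.

Definition gain_poly (d : nat) (c : nat -> R) : {poly R} :=
  'X^d + \poly_(s < d) c s.

End LinearODE.

Section Controller.
Context {R : realType} {n p : nat}.

Record controller_data := ControllerData {
  yref : 'I_p -> R -> R ;
  uref : 'I_p -> R -> R ;
  ygain : 'I_p -> nat -> R ;
  ugain : 'I_p -> nat -> R }.

Variables (S : @affine_system R n p) (h : 'cV[R]_n -> 'cV[R]_p).
Variables (ell r : 'I_p -> nat) (c : controller_data).

Definition admissible_controller (J : set R) : Prop :=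
  [/\ forall k, Ck_on (r k) J (yref c k),
      forall k, Ck_on (ell k) J (uref c k),
      forall k, Hurwitz (gain_poly (r k) (ygain c k)) &
      forall k, Hurwitz (gain_poly (ell k) (ugain c k))].

Definition Amx (x : 'cV[R]_(pdim n ell)) : 'M[R]_p :=
  decoupling (prolongation S ell) (prolonged_y h ell) r x.

Definition bvec (x : 'cV[R]_(pdim n ell)) : 'cV[R]_p :=
  \col_k lie_iter (drift (prolongation S ell)) (r k)
           (omap (prolonged_y h ell) k) x.

Definition qvec (x : 'cV[R]_(pdim n ell)) : 'cV[R]_(p + p) :=
  col_mx (bvec x) 0.

Definition Dmx (x : 'cV[R]_(pdim n ell)) : 'M[R]_(p + p, p) :=
  col_mx (Amx x) 1%:M.

Definition Gamma (A O : {set 'I_p}) : 'M[R]_(p, p + p) :=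
  \matrix_(a < p, b < p + p) (b == channel A O a)%:R.

Section Signals.
Variables (xi : R -> 'cV[R]_(pdim n ell)) (v : R -> 'cV[R]_p).

Definition ysignal (k : 'I_p) (t : R) : R := h (usubmx (xi t)) k 0.

Definition usignal (k : 'I_p) (t : R) : R :=
  if ell k == 0%N then v t k 0 else chain (xi t) k 0.

Definition yerror (k : 'I_p) (t : R) : R := yref c k t - ysignal k t.

Definition uerror (k : 'I_p) (t : R) : R := uref c k t - usignal k t.

Definition wvec (t : R) : 'cV[R]_(p + p) := col_mx
  (\col_k (derive1n (r k) (yref c k) t
           + \sum_(s < r k) ygain c k s * derive1n s (yerror k) t))
  (\col_k (derive1n (ell k) (uref c k) t
           + \sum_(s < ell k) ugain c k s * derive1n s (uerror k) t)).

(* wvec uses the time derivatives of the error signals along the trajectory xi;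
   v enters it only through the channels u_k = v_k with ell k = 0, for which the
   sum of error derivatives is empty, so the law for v t is explicit. *)
Definition regulates (A O : {set 'I_p}) (t : R) : Prop :=
  v t = invmx (Gamma A O *m Dmx (xi t))
          *m (- (Gamma A O *m qvec (xi t)) + Gamma A O *m wvec t).

End Signals.
End Controller.

Arguments regulates {R n p} S h {ell} r c xi v A O t.

(* Main.v *)
From HB Require Import structures.
Require Import Defs.
From mathcomp Require Import all_boot all_order all_algebra.
From mathcomp Require Import complex.
From mathcomp Require Import all_classical all_reals all_analysis.
From mathcomp Require Import ring lra.
Import Order.TTheory GRing.Theory Num.Theory.
Import numFieldNormedType.Exports.
Local Open Scope ring_scope.
Local Open Scope classical_set_scope.

(**
While a selection containing a given channel is regulated, the row of that
channel in [Gamma D v = - Gamma q + Gamma w] does not depend on the other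
channels selected, and it says that the last derivative of its error is the one
prescribed by its gains.  So the assigned equation holds off the switching time.
The error and its derivatives of order less than the degree are functions of
[t] and of the state alone, hence continuous across the switch; the highest
derivative then has a limit at the switch, and by l'Hopital's rule it exists
there and equals that limit, although the input [v] may jump.

Exponential stability: if the roots of the gain polynomial are [z_1, ..., z_d]
and [f_k = (D - z_1) ... (D - z_k) e], then [f_k' = z_(k+1) f_k + f_(k+1)] and
[f_d = 0].  This triangular system has the Lyapunov function
[\sum_k w^k |f_k|^2] for [w = 2 / mu^2], where [Re z_i <= - mu < 0].
*)

Set Implicit Arguments.
Unset Strict Implicit.
Unset Printing Implicit Defensive.

(** * Exponential stability *)

Section SquaredNorm.
Context {R : realType}.
Implicit Types (a b z : R[i]).

Definition nsq z : R := complex.Re z ^+ 2 + complex.Im z ^+ 2.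

Lemma nsq_ge0 z : 0 <= nsq z.
Proof. by rewrite addr_ge0 ?sqr_ge0. Qed.

Lemma nsq0 : nsq 0 = 0.
Proof. by rewrite /nsq expr0n addr0. Qed.

Lemma nsq_real (x : R) : nsq (real_complex R x) = x ^+ 2.
Proof. by rewrite /nsq /= expr0n addr0. Qed.

Lemma nsqM a b : nsq (a * b) = nsq a * nsq b.
Proof. by case: a b => [a a'] [b b']; rewrite /nsq /=; ring. Qed.

Lemma nsqD_le a b : nsq (a + b) <= 2 * nsq a + 2 * nsq b.
Proof.
case: a b => [a a'] [b b']; rewrite /nsq /=.
have := sqr_ge0 (a - b); have := sqr_ge0 (a' - b'); nra.
Qed.

(** Comparison of squared moduli with a real quantity, with one constant for all arguments. Only the
    existence of the constant matters. *)
Definition nsq_dominated (X : Type) (f : X -> R[i]) (g : X -> R) : Prop :=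
  exists2 C : R, 0 <= C & forall x, nsq (f x) <= C * g x.

Lemma nsq_dominatedD (X : Type) (f1 f2 : X -> R[i]) g :
  nsq_dominated f1 g -> nsq_dominated f2 g ->
  nsq_dominated (fun x => f1 x + f2 x) g.
Proof.
move=> [C1 C1_ge0 f1_le] [C2 C2_ge0 f2_le].
exists (2 * C1 + 2 * C2) => [|x]; first by lra.
by have := nsqD_le (f1 x) (f2 x); have := f1_le x; have := f2_le x; lra.
Qed.

Lemma nsq_dominatedMl (X : Type) a (f : X -> R[i]) g :
  nsq_dominated f g -> nsq_dominated (fun x => a * f x) g.
Proof.
move=> [C C_ge0 f_le]; exists (nsq a * C) => [|x].
  by rewrite mulr_ge0 ?nsq_ge0.
by rewrite nsqM -mulrA ler_wpM2l ?nsq_ge0.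
Qed.

Lemma nsq_dominated_sum (X : Type) n (f : 'I_n -> X -> R[i]) g :
  (forall i, nsq_dominated (f i) g) ->
  nsq_dominated (fun x => \sum_(i < n) f i x) g.
Proof.
elim: n f => [|n IHn] f f_dom.
  by exists 0 => // x; rewrite big_ord0 nsq0 mul0r.
under eq_fun do rewrite big_ord_recr/=.
by apply: nsq_dominatedD => //; apply: IHn.
Qed.

End SquaredNorm.

Section DifferentialPolynomials.
Context {R : realType} (d : nat).
Implicit Types (y : nat -> R) (Q : {poly R[i]}).

(* If y i is the i-th derivative of e at t, this is (Q(d/dt) e)(t). *)
Definition jet_eval y Q : R[i] :=
  \sum_(i < d.+1) Q`_i * real_complex R (y i).

Lemma jet_evalD y P Q : jet_eval y (P + Q) = jet_eval y P + jet_eval y Q.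
Proof.
by rewrite -big_split/=; apply: eq_bigr => i _; rewrite coefD mulrDl.
Qed.

Lemma jet_evalZ y a Q : jet_eval y (a *: Q) = a * jet_eval y Q.
Proof. by rewrite mulr_sumr; apply: eq_bigr => i _; rewrite coefZ mulrA. Qed.

(** Multiplication by ['X] is differentiation of the jet. The size bound kills the coefficient of
    degree [d], so the truncation at order [d] loses nothing. *)
Lemma jet_evalMX y Q : (size Q <= d)%N ->
  jet_eval y (Q * 'X) = jet_eval (fun i => y i.+1) Q.
Proof.
move=> sQ; rewrite /jet_eval big_ord_recl big_ord_recr/= coefMX/= mul0r add0r.
rewrite [Q`_d]nth_default// mul0r addr0.
by apply: eq_bigr => i _; rewrite coefMX.
Qed.

Lemma jet_eval_Xn y s : (s <= d)%N -> jet_eval y 'X^s = real_complex R (y s).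
Proof.
move=> sd; rewrite /jet_eval (bigD1 (Ordinal (sd : (s < d.+1)%N)))//=.
rewrite coefXn eqxx mul1r big1 ?addr0// => i.
by rewrite -val_eqE/= coefXn => /negPf ->; rewrite mul0r.
Qed.

Lemma jet_eval_dominated Q : (size Q <= d)%N ->
  nsq_dominated (jet_eval ^~ Q) (fun y => (\sum_(i < d) `|y i|) ^+ 2).
Proof.
move=> sQ; apply: nsq_dominated_sum => i.
exists (nsq Q`_i) => [|y]; first exact: nsq_ge0.
have [id|di] := ltnP i d; last first.
  by rewrite nth_default ?(leq_trans sQ)// mul0r nsq0 mul0r.
rewrite nsqM nsq_real ler_wpM2l ?nsq_ge0// -[_ ^+ 2]real_normK ?num_real//.
rewrite lerXn2r ?nnegrE ?sumr_ge0// (bigD1 (Ordinal id))//= lerDl.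
exact: sumr_ge0.
Qed.

End DifferentialPolynomials.

(** * A quadratic Lyapunov function attached to a list of roots *)

Section Lyapunov.
Context {R : realType} (rs : seq R[i]) (w : R).
Hypothesis w_gt0 : 0 < w.
Let d := size rs.
Implicit Types (y : nat -> R).

Definition prefix_poly k : {poly R[i]} :=
  \prod_(z <- take k rs) ('X - z%:P).

Lemma monic_prefix_poly k : prefix_poly k \is monic.
Proof. exact: monic_prod_XsubC. Qed.

Lemma size_prefix_poly k : (k <= d)%N -> size (prefix_poly k) = k.+1.
Proof. by move=> kd; rewrite size_prod_XsubC size_takel. Qed.

Lemma prefix_polyS k : (k < d)%N ->
  prefix_poly k.+1 = prefix_poly k * 'X - rs`_k *: prefix_poly k.
Proof.
move=> kd; rewrite /prefix_poly (take_nth 0)// -cats1 big_cat/= big_seq1.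
by rewrite mulrBr [_ * _%:P]mulrC mul_polyC.
Qed.

(** The weight [w] stays free here: it is chosen later from the distance of the roots to the
    imaginary axis. *)
Definition lyapunov y : R :=
  \sum_(k < d) w ^+ k * nsq (jet_eval d y (prefix_poly k)).

Lemma lyapunov_le : exists2 C : R, 0 <= C &
  forall y, lyapunov y <= C * (\sum_(i < d) `|y i|) ^+ 2.
Proof.
have dom (k : 'I_d) : exists C : R, forall y, 0 <= C /\
    w ^+ k * nsq (jet_eval d y (prefix_poly k)) <=
      C * (\sum_(i < d) `|y i|) ^+ 2.
  have [|C C_ge0 C_le] := @jet_eval_dominated R d (prefix_poly k).
    by rewrite size_prefix_poly// ltnW.
  have w_ge0 : 0 <= w ^+ k by rewrite exprn_ge0// ltW.
  exists (w ^+ k * C) => y; split; first exact: mulr_ge0.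
  by rewrite -mulrA ler_wpM2l.
have [C C_le] := choice dom.
exists (\sum_k C k) => [|y].
  by apply: sumr_ge0 => k _; have [] := C_le k (fun=> 0).
by rewrite mulr_suml; apply: ler_sum => k _; have [] := C_le k y.
Qed.

(** The polynomials [prefix_poly k] with [k < d] are monic of degrees 0, ..., d - 1, hence a basis
    of the polynomials of size at most [d]. Induction on the size: a multiple of [prefix_poly k]
    removes the leading term of [Q]. *)
Lemma jet_eval_le_lyapunov (Q : {poly R[i]}) : (size Q <= d)%N ->
  nsq_dominated (jet_eval d ^~ Q) lyapunov.
Proof.
move: {2}(size Q) (leqnn (size Q)) => k; elim: k Q => [|k IHk] Q sQ kd.
  move: sQ; rewrite leqn0 size_poly_eq0 => /eqP ->.
  exists 0 => // y; rewrite mul0r /jet_eval big1 ?nsq0// => i _.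
  by rewrite coef0 mul0r.
have [sQk|sQk] := leqP (size Q) k; first exact: IHk.
have {}kd : (k < d)%N by rewrite (leq_trans sQk).
pose P := Q - Q`_k *: prefix_poly k.
have sP : (size P <= k)%N.
  apply/leq_sizeP => j; rewrite leq_eqVlt coefB coefZ => /orP[/eqP <-|kj].
    have /monicP := monic_prefix_poly k.
    rewrite lead_coefE size_prefix_poly ?(ltnW kd)//= => ->.
    by rewrite mulr1 subrr.
  rewrite [Q`_j]nth_default ?(leq_trans sQ)//.
  rewrite [_`_j]nth_default ?mulr0 ?subr0//.
  by rewrite size_prefix_poly// ltnW.
have [||C C_ge0 C_le] := @nsq_dominatedD R _ (jet_eval d ^~ P)
    (fun y => Q`_k * jet_eval d y (prefix_poly k)) lyapunov.
- by apply: IHk => //; rewrite (leq_trans sP)// ltnW.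
(* The squared modulus weighted by [w ^+ k] is one of the nonnegative summands of [lyapunov]; hence
   the constant. *)
- apply: nsq_dominatedMl; exists (w ^+ k)^-1 => [|y].
    by rewrite invr_ge0 exprn_ge0// ltW.
  rewrite -ler_pdivrMl ?invr_gt0 ?exprn_gt0// invrK.
  rewrite /lyapunov (bigD1 (Ordinal kd))//= lerDl.
  by apply: sumr_ge0 => i _; rewrite mulr_ge0 ?nsq_ge0// exprn_ge0// ltW.
- exists C => // y; have := C_le y.
  by rewrite -jet_evalZ -jet_evalD subrK.
Qed.

End Lyapunov.

(** Differential form of Gronwall's inequality: [expR (a * s) * V s] has a nonpositive
    derivative. *)
Lemma exp_decay (R : realType) (J : set R) (V dV : R -> R) (a : R) :
  is_interval J ->
  (forall t, J t -> is_derive t 1 V (dV t)) ->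
  (forall t, J t -> dV t <= - a * V t) ->
  forall t0 t, J t0 -> J t -> t0 <= t ->
  V t <= expR (- a * (t - t0)) * V t0.
Proof.
move=> J_itv V_dV dV_le t0 t Jt0 Jt t0t.
pose g s := expR (a * s) * V s.
have sJ s : t0 <= s <= t -> J s by exact: J_itv.
have g_dg s : J s -> is_derive s 1 g (expR (a * s) * (a * V s + dV s)).
  move=> Js; have dVs := V_dV s Js.
  have da : is_derive s 1 (fun u : R => a * u) a.
    have := @is_deriveZ R R R id a s 1 1 (is_derive_id s (1 : R)).
    by rewrite [a *: 1]mulr1.
  have de : is_derive s 1 (fun u : R => expR (a * u)) (expR (a * s) * a).
    exact: (@is_derive1_comp R expR (fun u => a * u) s).
  have -> : expR (a * s) * (a * V s + dV s) =
      expR (a * s) *: dV s + V s *: (expR (a * s) * a).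
    by rewrite /GRing.scale/=; ring.
  exact: is_deriveM.
have gdec : g t <= g t0.
  apply: (@ler0_derive1_le_cc R g t0 t); rewrite ?in_itv/= ?lexx ?t0t//.
  - move=> s; rewrite in_itv/= => /andP[/ltW t0s /ltW st].
    by apply: (@ex_derive _ _ _ _ _ _ _ (g_dg s _)); apply: sJ; rewrite t0s.
  - move=> s; rewrite in_itv/= => /andP[/ltW t0s /ltW st].
    have Js : J s by apply: sJ; rewrite t0s.
    rewrite derive1E (@derive_val _ _ _ _ _ _ _ (g_dg s Js)).
    by rewrite pmulr_rle0 ?expR_gt0//; have := dV_le s Js; lra.
  - apply: derivable_within_continuous => s; rewrite in_itv/= => /sJ Js.
    exact: (@ex_derive _ _ _ _ _ _ _ (g_dg s Js)).
rewrite -(ler_pM2l (expR_gt0 (a * t))) mulrA -expRD.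
by rewrite (_ : a * t + _ = a * t0)//; ring.
Qed.

(** * Differentiating jets, and the damping of one equation of the triangular system *)

Section Stability.
Context {R : realType}.

Lemma Re_jet_eval d (y : nat -> R) (Q : {poly R[i]}) :
  complex.Re (jet_eval d y Q) = \sum_(i < d.+1) complex.Re Q`_i * y i.
Proof.
rewrite (raddf_sum (@complex.Re R : Rcomplex R -> R)); apply: eq_bigr => i _.
by case: (Q`_i) => a b /=; rewrite mulr0 subr0.
Qed.

Lemma Im_jet_eval d (y : nat -> R) (Q : {poly R[i]}) :
  complex.Im (jet_eval d y Q) = \sum_(i < d.+1) complex.Im Q`_i * y i.
Proof.
rewrite (raddf_sum (@complex.Im R : Rcomplex R -> R)); apply: eq_bigr => i _.
by case: (Q`_i) => a b /=; rewrite mulr0 add0r.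
Qed.

(** Meant for [phi] the real or the imaginary part, so that only real functions are differentiated.
    Since [phi 0 = 0], the summand of order [d], whose derivability is not assumed, vanishes. *)
Lemma is_derive_jet d (phi : R[i] -> R) (e : R -> R) (t : R) (Q : {poly R[i]}) :
  phi 0 = 0 ->
  (forall s, (s < d)%N -> derivable (derive1n s e) t 1) ->
  (size Q <= d)%N ->
  is_derive t 1 (fun u => \sum_(i < d.+1) phi Q`_i * derive1n i e u)
    (\sum_(i < d.+1) phi Q`_i * derive1n i.+1 e t).
Proof.
move=> phi0 e_d sQ.
have -> : (fun u => \sum_(i < d.+1) phi Q`_i * derive1n i e u) =
    \sum_(i < d.+1) (fun u => phi Q`_i * derive1n i e u).
  by apply: funext => u; rewrite fct_sumE.
apply: is_derive_sum => i.
have [id|di] := ltnP i d; last first.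
  rewrite nth_default ?(leq_trans sQ)// phi0 mul0r.
  by under eq_fun do rewrite mul0r; exact: is_derive_cst.
have /derivableP := e_d i id; rewrite -derive1E -derive1nS => /is_deriveZ.
exact.
Qed.

(* The left-hand side is the derivative of |f|^2 when f' = z f + g. *)
Lemma cross_term_le (mu f1 f2 g1 g2 : R) (z : R[i]) : 0 < mu ->
  complex.Re z <= - mu ->
  2 * (f1 * (complex.Re z * f1 - complex.Im z * f2 + g1)
       + f2 * (complex.Re z * f2 + complex.Im z * f1 + g2)) <=
  - mu * (f1 ^+ 2 + f2 ^+ 2) + mu^-1 * (g1 ^+ 2 + g2 ^+ 2).
Proof.
move=> mu_gt0 zmu.
(* Young's inequality with weight [mu]. The terms in [complex.Im z] cancel, so the bound on the real
   part suffices. *)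
have sq (f g : R) : 2 * (f * g) <= mu * f ^+ 2 + mu^-1 * g ^+ 2.
  rewrite -subr_ge0 (_ : _ - _ = mu^-1 * (mu * f - g) ^+ 2).
    by rewrite mulr_ge0 ?sqr_ge0// invr_ge0 ltW.
  by field; rewrite gt_eqF.
have sq1 := sq f1 g1; have sq2 := sq f2 g2.
have : complex.Re z * (f1 ^+ 2 + f2 ^+ 2) <= - mu * (f1 ^+ 2 + f2 ^+ 2).
  by rewrite ler_wpM2r// addr_ge0 ?sqr_ge0.
lra.
Qed.

End Stability.

Section Hurwitz.
Context {R : realType}.

(** The gain polynomial is monic of degree [d] and splits over the complex numbers; finitely many
    roots in the open left half-plane have a common margin [mu]. *)
Lemma Hurwitz_roots d (c : nat -> R) : Hurwitz (gain_poly d c) ->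
  exists (rs : seq R[i]) (mu : R),
    [/\ size rs = d, 0 < mu,
        forall k, (k < d)%N -> complex.Re rs`_k <= - mu &
        map_poly (real_complex R) (gain_poly d c) =
          \prod_(z <- rs) ('X - z%:P)].
Proof.
set P := map_poly _ _ => P_Hurwitz.
have sg : size (gain_poly d c) = d.+1.
  by rewrite /gain_poly size_polyDl size_polyXn// ltnS size_poly.
have P_monic : P \is monic.
  rewrite map_monic monicE lead_coefE sg/= coefD coefXn eqxx coef_poly ltnn.
  by rewrite addr0.
have sP : size P = d.+1 by rewrite size_map_poly.
have [rs Prs] := closed_field_poly_normal P.
rewrite (monicP P_monic) scale1r in Prs.
have srs : size rs = d by move: sP; rewrite Prs size_prod_XsubC => -[].
have Re_lt0 z : z \in rs -> complex.Re z < 0.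
  by move=> zrs; apply: P_Hurwitz; rewrite -/P Prs root_prod_XsubC.
have [mu mu_gt0 mu_le] : exists2 mu : R, 0 < mu &
    forall z, z \in rs -> complex.Re z <= - mu.
  (* The margin is a minimum over the list of roots, started at 1 for the empty list. *)
  elim: {P Prs sP P_monic P_Hurwitz srs} rs Re_lt0 => [|z rs IHrs] Re_lt0.
    by exists 1.
  have [z' z'rs|mu mu_gt0 mu_le] := IHrs.
    by apply: Re_lt0; rewrite in_cons z'rs orbT.
  exists (Num.min mu (- complex.Re z)) => [|z'].
    by rewrite lt_min mu_gt0 oppr_gt0 Re_lt0 ?mem_head.
  rewrite in_cons => /predU1P[->|/mu_le z'mu]; rewrite lerNr ge_min.
    by rewrite lexx orbT.
  by rewrite lerNr z'mu.
by exists rs, mu; split => // k kd; apply: mu_le; rewrite mem_nth// srs.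
Qed.

(** Translates the assigned equation into jets: along a solution the last function of the triangular
    system is zero. *)
Lemma jet_eval_gain_poly d (c : nat -> R) (y : nat -> R) :
  jet_eval d y (map_poly (real_complex R) (gain_poly d c)) =
  real_complex R (y d + \sum_(s < d) c s * y s).
Proof.
rewrite [RHS]raddfD/= [X in _ = _ + X]raddf_sum/=.
rewrite /jet_eval big_ord_recr/= addrC.
congr (_ + _); last apply: eq_bigr => i _.
  by rewrite coef_map/= coefD coefXn eqxx coef_poly ltnn addr0 mul1r.
by rewrite coef_map/= coefD coefXn coef_poly ltn_ord ltn_eqF// add0r rmorphM.
Qed.

(** For w = 2 / mu^2 one has w^k / mu = (mu / 2) w^(k+1), so each coupling term costs half of the
    decay of the next summand. The last coupling term is zero since [N d = 0], and half of the decay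
    remains. *)
Lemma weighted_sum_le d (mu : R) (N : nat -> R) :
  0 < mu -> (forall k, 0 <= N k) -> N d = 0 ->
  \sum_(k < d) (2 / mu ^+ 2) ^+ k * (- mu * N k + mu^-1 * N k.+1) <=
  - (mu / 2) * \sum_(k < d) (2 / mu ^+ 2) ^+ k * N k.
Proof.
set w := 2 / _ => mu_gt0 N_ge0 Nd.
have sumE : \sum_(k < d) w ^+ k * (- mu * N k + mu^-1 * N k.+1) =
    - mu * (\sum_(k < d) w ^+ k * N k) +
    mu^-1 * (\sum_(k < d) w ^+ k * N k.+1).
  by rewrite !mulr_sumr -big_split/=; apply: eq_bigr => k _; ring.
suff : mu^-1 * (\sum_(k < d) w ^+ k * N k.+1) <=
    mu / 2 * (\sum_(k < d) w ^+ k * N k) by rewrite sumE; lra.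
case: d Nd {sumE} => [|d] Nd; first by rewrite !big_ord0 !mulr0.
rewrite big_ord_recr/= Nd mulr0 addr0 big_ord_recl expr0 mul1r mulrDr.
rewrite -[leLHS]add0r lerD//; first by rewrite mulr_ge0// divr_ge0// ltW.
rewrite !mulr_sumr; apply: ler_sum => k _; rewrite le_eqVlt; apply/orP; left.
by apply/eqP; rewrite ?lift0 /= exprS /w; field; rewrite gt_eqF.
Qed.

Lemma Hurwitz_exponentially_stable d (c : nat -> R) :
  Hurwitz (gain_poly d c) -> exponentially_stable d c.
Proof.
move=> /Hurwitz_roots[rs [mu [srs mu_gt0 mu_le Prs]]].
pose w := 2 / mu ^+ 2.
have w_gt0 : 0 < w by rewrite divr_gt0// exprn_gt0.
have [C1 C1_ge0 C1_le] := lyapunov_le rs w_gt0.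
have C2ex (s : 'I_d) : exists C : R, forall y : nat -> R, 0 <= C /\
    y s ^+ 2 <= C * lyapunov rs w y.
  have [|C C_ge0 C_le] := @jet_eval_le_lyapunov R rs w w_gt0 'X^s.
    by rewrite size_polyXn srs.
  exists C => y; split => //; have := C_le y.
  by rewrite srs jet_eval_Xn ?nsq_real// ltnW.
have [C2 C2_le] := choice C2ex.
(* [lyapunov] decays at rate [mu / 2]; being quadratic, it gives half that rate for the derivatives
   themselves. Summing over all orders makes the constant independent of [s]. *)
exists (Num.sqrt (\sum_s C2 s * C1)), (mu / 4).
split; first by rewrite divr_gt0.
move=> J e J_open J_itv e_lti t0 t Jt0 Jt t0t s sd.
pose y u := fun i => derive1n i e u.
pose q k := prefix_poly rs k.
pose F k u := jet_eval d (y u) (q k).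
have sq k : (k < d)%N -> (size (q k) <= d)%N.
  by move=> kd; rewrite size_prefix_poly ?srs// ltnW.
(* This is the derivative of [F k], and the next identity is the triangular system. *)
pose F' k u := jet_eval d (y u) (q k * 'X).
have F'E k u : (k < d)%N -> F' k u = rs`_k * F k u + F k.+1 u.
  move=> kd; rewrite /F /q prefix_polyS ?srs//.
  by rewrite jet_evalD -scaleNr jet_evalZ mulNr addrC subrK.
have Fd u : J u -> F d u = 0.
  move=> Ju; rewrite /F /q /prefix_poly take_oversize ?srs// -Prs.
  by rewrite jet_eval_gain_poly (e_lti u Ju).2.
have dF k u : (k < d)%N -> J u -> is_derive u 1 (fun u => nsq (F k u))
    (2 * (complex.Re (F k u) * complex.Re (F' k u)
          + complex.Im (F k u) * complex.Im (F' k u))).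
  move=> kd Ju; have [e_d _] := e_lti u Ju.
  have dRe : is_derive u 1 (fun u => complex.Re (F k u)) (complex.Re (F' k u)).
    rewrite /F' jet_evalMX ?sq// Re_jet_eval.
    under eq_fun do rewrite Re_jet_eval.
    exact: (@is_derive_jet R d (@complex.Re R) e u (q k) erefl e_d (sq k kd)).
  have dIm : is_derive u 1 (fun u => complex.Im (F k u)) (complex.Im (F' k u)).
    rewrite /F' jet_evalMX ?sq// Im_jet_eval.
    under eq_fun do rewrite Im_jet_eval.
    exact: (@is_derive_jet R d (@complex.Im R) e u (q k) erefl e_d (sq k kd)).
  have -> : (fun u => nsq (F k u)) =
      (fun u => complex.Re (F k u)) ^+ 2 + (fun u => complex.Im (F k u)) ^+ 2.
    by apply: funext => z; rewrite !fctE.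
  have -> : 2 * (complex.Re (F k u) * complex.Re (F' k u)
                + complex.Im (F k u) * complex.Im (F' k u)) =
      (2 * complex.Re (F k u) ^+ 1) *: complex.Re (F' k u)
      + (2 * complex.Im (F k u) ^+ 1) *: complex.Im (F' k u).
    by rewrite /GRing.scale/= !expr1 mulrDr !mulrA.
  exact: is_deriveD (is_deriveX 2 dRe) (is_deriveX 2 dIm).
pose V u := lyapunov rs w (y u).
have dV u : J u -> is_derive u 1 V
    (\sum_(k < d) w ^+ k * (2 * (complex.Re (F k u) * complex.Re (F' k u)
                              + complex.Im (F k u) * complex.Im (F' k u)))).
  move=> Ju.
  have -> : V = \sum_(k < d) (fun u => w ^+ k * nsq (F k u)).
    by apply: funext => z; rewrite fct_sumE /V /lyapunov srs.
  apply: is_derive_sum => k.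
  by have /is_deriveZ := dF k u (ltn_ord k) Ju; exact.
have V_decay : V t <= expR (- (mu / 2) * (t - t0)) * V t0.
  apply: (exp_decay J_itv dV) => // u Ju.
  apply: (@le_trans _ _ (\sum_(k < d) w ^+ k *
      (- mu * nsq (F k u) + mu^-1 * nsq (F k.+1 u)))).
    apply: ler_sum => k _; rewrite ler_wpM2l ?exprn_ge0 ?(ltW w_gt0)//.
    rewrite F'E//.
    have := @cross_term_le R mu (complex.Re (F k u)) (complex.Im (F k u))
      (complex.Re (F k.+1 u)) (complex.Im (F k.+1 u)) rs`_k mu_gt0
      (mu_le k (ltn_ord k)).
    by case: (F k u) (F k.+1 u) (rs`_k) => [? ?] [? ?] [? ?].
  rewrite /V /lyapunov srs.
  by apply: (@weighted_sum_le d mu (fun k => nsq (F k u))) => // [k|];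
    rewrite ?nsq_ge0// Fd// nsq0.
have C2_ge0 i : 0 <= C2 i by have [] := C2_le i (fun=> 0).
have CC_ge0 : 0 <= \sum_i C2 i * C1.
  by apply: sumr_ge0 => i _; rewrite mulr_ge0.
have S_ge0 : 0 <= \sum_(i < d) `|y t0 i| by exact: sumr_ge0.
rewrite -ler_sqr ?nnegrE ?mulr_ge0 ?sqrtr_ge0 ?expR_ge0 ?S_ge0//.
rewrite real_normK ?num_real// !exprMn sqr_sqrtr//.
have -> : expR (- (mu / 4) * (t - t0)) ^+ 2 = expR (- (mu / 2) * (t - t0)).
  by rewrite -expRM_natl; congr expR; field.
have [_ /le_trans] := C2_le (Ordinal sd) (y t); apply.
apply: (@le_trans _ _ (C2 (Ordinal sd) *
    (expR (- (mu / 2) * (t - t0)) * (C1 * (\sum_(i < d) `|y t0 i|) ^+ 2)))).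
  rewrite ler_wpM2l//; apply: (le_trans V_decay).
  by rewrite ler_wpM2l ?expR_ge0//; have := C1_le (y t0); rewrite srs.
rewrite [leLHS](_ : _ = C2 (Ordinal sd) * C1 *
  (expR (- (mu / 2) * (t - t0)) * (\sum_(i < d) `|y t0 i|) ^+ 2)); last by ring.
rewrite -[leRHS]mulrA ler_wpM2r ?(mulr_ge0 (expR_ge0 _)) ?sqr_ge0//.
rewrite (bigD1 (Ordinal sd))//= lerDl.
by apply: sumr_ge0 => i _; rewrite mulr_ge0.
Qed.

End Hurwitz.

(** * Calculus of C^k maps *)

Section SmoothCalculus.
Context {R : realType}.

(** The first-order expansion of [f] is also one of [g], and uniqueness of the differential
    identifies the two differentials. *)
Lemma near_eq_differentiable (V W : normedModType R) (f g : V -> W) (x : V) :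
  (\near x, f x = g x) -> differentiable f x -> differentiable g x.
Proof.
move=> fg /diff_locallyP[dfc dfE].
have gE : g \o shift x = cst (g x) + 'd f x +o_ (0 : V) id.
  apply/eqaddoP => e e0; move/eqaddoP/(_ e e0) : dfE => f_le.
  have fg0 : \forall h \near (0 : V), f (h + x) = g (h + x).
    by move: fg; rewrite (near_shift 0 x) subr0.
  apply: filterS2 f_le fg0 => h; rewrite !fctE/= -(nbhs_singleton fg).
  by move=> + <-.
have dE : 'd g x = 'd f x :> (V -> W) by exact: diff_unique.
by apply/diff_locallyP; split; rewrite dE.
Qed.

Lemma open_eq_near (V : topologicalType) (T : Type) (U : set V) (f g : V -> T)
    (x : V) :
  open U -> U x -> (forall y, U y -> f y = g y) -> \near x, f x = g x.
Proof. by move=> oU Ux fg; apply: filterS fg _; exact: open_nbhs_nbhs. Qed.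

Section Ck.
Context {V W : normedModType R}.
Variable U : set V.
Hypothesis U_open : open U.
Implicit Types f g : V -> W.

(** As [U] is open, equality on [U] is equality near each of its points and passes to the
    derivatives. *)
Lemma eq_Ck_on k f g : (forall x, U x -> f x = g x) ->
  Ck_on k U f -> Ck_on k U g.
Proof.
elim: k f g => [|k IHk] f g fg.
  move=> f_cont x Ux; have := f_cont x Ux; rewrite /prop_for /continuous_at.
  rewrite (fg x Ux); apply: cvg_trans; apply: near_eq_cvg.
  exact: open_eq_near fg.
move=> [f_diff Df_Ck]; split=> [x Ux|v].
  by apply: near_eq_differentiable (f_diff x Ux); exact: open_eq_near fg.
apply: IHk (Df_Ck v) => x Ux; apply: near_eq_derive; exact: open_eq_near fg.
Qed.

Lemma Ck_onW k f : Ck_on k.+1 U f -> Ck_on k U f.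
Proof.
elim: k f => [|k IHk] f [f_diff Df_Ck].
  by move=> x Ux; apply: differentiable_continuous; exact: f_diff.
by split=> // v; apply: IHk; exact: Df_Ck.
Qed.

Lemma Ck_on_cst k (a : W) : Ck_on k U (cst a).
Proof.
elim: k a => [|k IHk] a; first by move=> x _; exact: cst_continuous.
split=> [x _|v]; first exact: differentiable_cst.
by apply: (eq_Ck_on _ (IHk 0)) => x _; rewrite derive_cst.
Qed.

Lemma Ck_on_linear k (L : {linear V -> W}) : continuous L -> Ck_on k U L.
Proof.
move=> L_cont; case: k => [|k]; first by move=> x _; exact: L_cont.
split=> [x _|v]; first exact: linear_differentiable.
apply: (eq_Ck_on _ (Ck_on_cst k (L v))) => x _.
by rewrite deriveE; [rewrite diff_lin|exact: linear_differentiable].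
Qed.

Lemma Ck_onD k f g : Ck_on k U f -> Ck_on k U g -> Ck_on k U (f + g).
Proof.
elim: k f g => [|k IHk] f g.
  by move=> fc gc x Ux; apply: continuousD; [exact: fc|exact: gc].
move=> [fd Df] [gd Dg]; split=> [x Ux|v].
  by apply: differentiableD; [exact: fd|exact: gd].
apply: (eq_Ck_on _ (IHk _ _ (Df v) (Dg v))) => x Ux.
by rewrite deriveD; [|exact/diff_derivable/fd|exact/diff_derivable/gd].
Qed.

Lemma Ck_on_sum k n (f : 'I_n -> V -> W) :
  (forall i, Ck_on k U (f i)) -> Ck_on k U (\sum_(i < n) f i).
Proof.
move=> f_Ck; elim/big_ind : _ => [|g h|i _]; [exact: Ck_on_cst|exact: Ck_onD|].
exact: f_Ck.
Qed.

End Ck.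

(** Leibniz's rule leaves one factor underived; [Ck_onW] lowers its order to that of the derived
    factor. *)
Lemma Ck_onM (V : normedModType R) (U : set V) k (f g : V -> R) : open U ->
  Ck_on k U f -> Ck_on k U g -> Ck_on k U (f * g).
Proof.
move=> U_open; elim: k f g => [|k IHk] f g.
  by move=> fc gc x Ux; apply: continuousM; [exact: fc|exact: gc].
move=> fk gk; have [fd Df] := fk; have [gd Dg] := gk; split=> [x Ux|v].
  by apply: differentiableM; [exact: fd|exact: gd].
have := Ck_onD U_open (IHk _ _ (Ck_onW fk) (Dg v)) (IHk _ _ (Ck_onW gk) (Df v)).
apply: eq_Ck_on => // x Ux.
by rewrite deriveM; [|exact/diff_derivable/fd|exact/diff_derivable/gd].
Qed.

Lemma derive_comp_linear (V V' W : normedModType R) (A : {linear V -> V'})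
    (f : V' -> W) (x v : V) : continuous A -> differentiable f (A x) ->
  'D_v (f \o A) x = 'D_(A v) f (A x).
Proof.
move=> A_cont f_diff.
have A_diff : differentiable A x by exact: linear_differentiable.
rewrite !deriveE//; last exact: differentiable_comp.
by rewrite diff_comp//= diff_lin.
Qed.

Lemma Ck_on_precomp_linear (V V' W : normedModType R) (A : {linear V -> V'})
    (U : set V') k (f : V' -> W) : continuous A -> open U ->
  Ck_on k U f -> Ck_on k (A @^-1` U) (f \o A).
Proof.
move=> A_cont U_open.
have AU_open : open (A @^-1` U) by apply: open_comp => // x _; exact: A_cont.
elim: k f => [|k IHk] f.
  by move=> fc x Ux; apply: continuous_comp; [exact: A_cont|exact: fc].
move=> [fd Df]; split=> [x Ux|v].
  by apply: differentiable_comp; [exact: linear_differentiable|exact: fd].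
apply: (eq_Ck_on AU_open _ (IHk _ (Df (A v)))) => x Ux.
by rewrite derive_comp_linear//; exact: fd.
Qed.

Lemma Ck_on_postcomp_linear (V W W' : normedModType R) (L : {linear W -> W'})
    (U : set V) k (f : V -> W) : continuous L -> open U ->
  Ck_on k U f -> Ck_on k U (L \o f).
Proof.
move=> L_cont U_open; elim: k f => [|k IHk] f.
  by move=> fc x Ux; apply: continuous_comp; [exact: fc|exact: L_cont].
move=> [fd Df]; split=> [x Ux|v].
  by apply: differentiable_comp; [exact: fd|exact: linear_differentiable].
apply: (eq_Ck_on U_open _ (IHk _ (Df v))) => x Ux.
have f_diff := fd x Ux.
have L_diff : differentiable L (f x) by exact: linear_differentiable.
have Lf_diff : differentiable (L \o f) x by exact: differentiable_comp.
by rewrite (deriveE _ Lf_diff) diff_comp//= diff_lin//= deriveE.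
Qed.

(** By finite dimension: the map is a finite sum of coordinates times fixed vectors. *)
Lemma linear_cV_continuous N (W : normedModType R)
    (L : {linear 'cV[R]_N -> W}) : continuous L.
Proof.
have -> : (L : 'cV[R]_N -> W) =
    \sum_(i < N) (fun x : 'cV[R]_N => x i 0 *: L (delta_mx i 0)).
  apply: funext => x; rewrite fct_sumE {1}(matrix_sum_delta x) linear_sum.
  by apply: eq_bigr => i _; rewrite big_ord1 linearZ.
move=> x; elim/big_ind : _ => [|f g fc gc|i _]; first exact: cst_continuous.
  exact: continuousD.
by apply: continuousZr_tmp; exact: coord_continuous.
Qed.

End SmoothCalculus.

(** * Errors across a switch *)

Section RemovableSwitch.
Context {R : realType}.

(** L'Hopital's rule for [f - f ts] over [id - ts]: the quotient of the derivatives is [g], which is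
    continuous at [ts]. This is where a jump of the input is absorbed. *)
Lemma is_derive_removable (J : set R) (ts : R) (f g : R -> R) :
  open J -> J ts ->
  (forall t, J t -> {for t, continuous f}) -> {for ts, continuous g} ->
  (forall t, J t -> t != ts -> is_derive t 1 f (g t)) ->
  forall t, J t -> is_derive t 1 f (g t).
Proof.
move=> J_open J_ts f_cont g_cont f_g t Jt.
have [->|] := eqVneq t ts; last exact: f_g.
have [e /= e_gt0 eJ] := (nbhs_ballP ts J).1 (open_nbhs_nbhs (conj J_open J_ts)).
have J_itv x : x \in `]ts - e, ts + e[%R -> J x.
  by rewrite in_itv/= -ltr_distlC -/(ball_ _ _ _ _) => /eJ.
have quotient : (f x - f ts) / (x - ts) @[x --> ts^'] --> g ts.
  apply: (@lhopital R (f - cst (f ts)) g (id - cst ts) (cst 1)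
      (ts - e) (ts + e) ts).
  - by rewrite in_itv/= ltrBlDr !ltrDl e_gt0.
  - move=> x /set_mem[/= xe /eqP xts].
    have := f_g x (J_itv x xe) xts => dfx.
    have := is_deriveB dfx (is_derive_cst (f ts) x 1); rewrite subr0.
    exact.
  - move=> x _.
    have := is_deriveB (is_derive_id x (1 : R)) (is_derive_cst ts x 1).
    by rewrite subr0.
  - rewrite -[X in _ --> X](subrr (f ts)).
    by apply: cvgB; [exact: f_cont|exact: cvg_cst].
  - rewrite -[X in _ --> X](subrr ts).
    by apply: cvgB; [exact: cvg_id|exact: cvg_cst].
  - by move=> x _; exact: oner_neq0.
  - rewrite [X in X @ _ --> _](_ : _ = g)//.
    by apply: funext => x; rewrite divr1.
(* The same limit in terms of the increment [h = x - ts], the form in which derivatives are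
   defined. *)
have growth : h^-1 *: ((f \o shift ts) (h *: (1 : R)) - f ts) @[h --> 0^'] -->
    g ts.
  move: quotient => /cvgrPdist_lt quotient; apply/cvgrPdist_lt => eps eps_gt0.
  have : \forall x \near ts, x != ts -> `|g ts - (f x - f ts) / (x - ts)| < eps.
    exact: quotient.
  rewrite (near_shift 0 ts); apply: filterS => h /= + h0.
  rewrite subr0 addrK [h *: 1]mulr1 mulrC; apply.
  by rewrite -subr_eq0 addrK.
by apply: DeriveDef; [apply/cvg_ex; exists (g ts)|exact/cvg_lim].
Qed.

Lemma Ck_on_derive1n (V : normedModType R) (J : set R) s k (f : R -> V) :
  Ck_on (s + k) J f -> Ck_on k J (derive1n s f).
Proof.
elim: s f => [//|s IHs] f [_ Df]; rewrite derive1Sn; apply: IHs.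
have -> : derive1 f = 'D_1 f by apply: funext => t; rewrite derive1E.
exact: Df.
Qed.

Lemma Ck_on_is_derive (V : normedModType R) (J : set R) d s (f : R -> V) t :
  Ck_on d J f -> (s < d)%N -> J t ->
  is_derive t 1 (derive1n s f) (derive1n s.+1 f t).
Proof.
move=> f_Ck sd Jt; have [f_diff _] : Ck_on (d - s.+1).+1 J (derive1n s f).
  by apply: Ck_on_derive1n; rewrite -subSn// subSS subnKC// ltnW.
by rewrite derive1nS derive1E; apply/derivableP/diff_derivable/f_diff.
Qed.

Lemma Ck_on_continuous (V : normedModType R) (J : set R) d s (f : R -> V) t :
  Ck_on d J f -> (s <= d)%N -> J t -> {for t, continuous (derive1n s f)}.
Proof.
move=> f_Ck sd; have : Ck_on (d - s) J (derive1n s f).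
  by apply: Ck_on_derive1n; rewrite subnKC.
elim: (d - s)%N => [|k IHk]; first exact.
by move=> /Ck_onW.
Qed.

(** In the application [phi s] is the s-th Lie derivative of the channel along the trajectory: a
    function of the state, hence continuous at [ts], while the differential relations are known only
    off [ts]. The input enters the derivative of [phi d] only. *)
Lemma lti_solution_switch (d : nat) (c : nat -> R) (J : set R) (ts : R)
    (ref : R -> R) (phi : nat -> R -> R) :
  open J -> J ts -> Ck_on d.+1 J ref ->
  (forall s t, (s <= d)%N -> J t -> {for t, continuous (phi s)}) ->
  (forall s t, (s < d)%N -> J t -> t != ts ->
     is_derive t 1 (phi s) (phi s.+1 t)) ->
  (forall t, J t -> t != ts -> is_derive t 1 (phi d)
     (derive1n d.+1 ref t +
      \sum_(s < d.+1) c s * derive1n s (fun u => ref u - phi 0%N u) t)) ->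
  lti_solution d.+1 c J (fun t => ref t - phi 0%N t).
Proof.
move=> J_open J_ts ref_Ck phi_cont phi_d phi_d_last.
set e := fun t => ref t - phi 0%N t.
have phi_derive s t : (s < d)%N -> J t -> is_derive t 1 (phi s) (phi s.+1 t).
  move=> sd; apply: (is_derive_removable J_open J_ts) => [u|u|u].
  - exact: (phi_cont s u (ltnW sd)).
  - exact: (phi_cont s.+1).
  - exact: phi_d.
have eE s t : (s <= d)%N -> J t -> derive1n s e t = derive1n s ref t - phi s t.
  elim: s t => [//|s IHs] t sd Jt.
  rewrite [in LHS]derive1nS derive1E.
  have -> : 'D_1 (derive1n s e) t = 'D_1 (derive1n s ref - phi s) t.
    apply: near_eq_derive; apply: (open_eq_near J_open Jt) => u Ju.
    by rewrite IHs// ltnW.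
  have dref := Ck_on_is_derive ref_Ck (ltnW sd : (s < d.+1)%N) Jt.
  have dphi := phi_derive s t sd Jt.
  by rewrite (@derive_val _ _ _ _ _ _ _ (is_deriveB dref dphi)).
have e_near s t : (s <= d)%N -> J t ->
    \near t, (derive1n s ref - phi s) t = derive1n s e t.
  by move=> sd Jt; apply: (open_eq_near J_open Jt) => u Ju; rewrite eE.
have e_cont s t : (s <= d)%N -> J t -> {for t, continuous (derive1n s e)}.
  move=> sd Jt; rewrite /prop_for /continuous_at eE//.
  have : (derive1n s ref u - phi s u) @[u --> t] -->
      derive1n s ref t - phi s t.
    apply: cvgB; last exact: phi_cont.
    exact: (Ck_on_continuous ref_Ck (leqW sd) Jt).
  apply: cvg_trans; apply: near_eq_cvg.
  by apply: (open_eq_near J_open Jt) => u Ju; rewrite eE.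
(* The value that the gains prescribe for the highest derivative. It involves orders up to [d] only,
   so it is continuous at [ts] and the singularity there is removable. *)
pose g t := - \sum_(s < d.+1) c s * derive1n s e t.
have e_last t : J t -> is_derive t 1 (derive1n d e) (g t).
  apply: (is_derive_removable J_open J_ts) => [u Ju||u Ju uts].
  - exact: e_cont.
  - have -> : g = - \sum_(s < d.+1) (fun t => c s * derive1n s e t).
      by apply: funext => u; rewrite /g !fctE fct_sumE.
    apply: continuousN; elim/big_ind : _ => [|f1 f2 cf1 cf2|s _].
    + exact: cst_continuous.
    + exact: continuousD.
    + apply: continuousM; first exact: cst_continuous.
      by apply: e_cont => //; rewrite -ltnS.
  - have dref := Ck_on_is_derive ref_Ck (ltnSn d) Ju.
    have := near_eq_is_derive (e_near d u (leqnn d) Ju)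
      (is_deriveB dref (phi_d_last u Ju uts)).
    by rewrite opprD addNKr.
move=> t Jt; split=> [s|].
  rewrite ltnS leq_eqVlt => /predU1P[->|sd].
    exact: (@ex_derive _ _ _ _ _ _ _ (e_last t Jt)).
  apply: near_eq_derivable (e_near s t (ltnW sd) Jt) _.
  apply: derivableB.
    exact: (@ex_derive _ _ _ _ _ _ _ (Ck_on_is_derive ref_Ck (leqW sd) Jt)).
  exact: (@ex_derive _ _ _ _ _ _ _ (phi_derive s t sd Jt)).
rewrite [in X in X + _]derive1nS derive1E.
by rewrite (@derive_val _ _ _ _ _ _ _ (e_last t Jt)) addNr.
Qed.

End RemovableSwitch.

(** * Channels of the prolonged system *)

Section LieDerivatives.
Context {R : realType} {N : nat}.
Implicit Types (U : set 'cV[R]_N) (F : 'cV[R]_N -> 'cV[R]_N).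

Definition cV_coord m (i : 'I_m) (x : 'cV[R]_m) : R := x i 0.

Fact cV_coord_is_linear m i : linear (@cV_coord m i).
Proof. by move=> a x y; rewrite /cV_coord !mxE. Qed.
HB.instance Definition _ m i :=
  GRing.isLinear.Build R 'cV[R]_m R _ (@cV_coord m i) (@cV_coord_is_linear m i).

Lemma derive_cV_sum (H : 'cV[R]_N -> R) (x w : 'cV[R]_N) : differentiable H x ->
  'D_w H x = \sum_(i < N) w i 0 * 'D_(delta_mx i 0) H x.
Proof.
move=> dH; rewrite deriveE// {1}(matrix_sum_delta w) linear_sum.
by apply: eq_bigr => i _; rewrite big_ord1 linearZ/= deriveE.
Qed.

(** [Ck_on] speaks of fixed directions, whereas [F x] varies with [x]. Expanding it on the canonical
    basis turns the Lie derivative into a finite sum of products of smooth functions. *)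
Lemma smooth_on_lie U F (H : 'cV[R]_N -> R) : open U ->
  (forall i, smooth_on U (cV_coord i \o F)) -> smooth_on U H ->
  smooth_on U (lie F H).
Proof.
move=> U_open F_smooth H_smooth k; have [H_diff DH] := H_smooth k.+1.
apply: (@eq_Ck_on _ _ _ _ U_open _
    (\sum_(i < N) (cV_coord i \o F) * ('D_(delta_mx i 0) H))).
  by move=> x Ux; rewrite /lie derive_cV_sum ?fct_sumE//; exact: H_diff.
apply: Ck_on_sum => // i; by apply: Ck_onM => //; [exact: F_smooth|exact: DH].
Qed.

Lemma smooth_on_lie_iter U F (H : 'cV[R]_N -> R) s : open U ->
  (forall i, smooth_on U (cV_coord i \o F)) -> smooth_on U H ->
  smooth_on U (lie_iter F s H).
Proof.
move=> U_open F_smooth H_smooth; elim: s => [//|s IHs].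
exact: smooth_on_lie.
Qed.

Lemma is_derive_trajectory m (S : @affine_system R N m) (H : 'cV[R]_N -> R)
    (xi : R -> 'cV[R]_N) (v : 'cV[R]_m) (t : R) :
  differentiable H (xi t) -> is_derive t 1 xi (dynamics S (xi t) v) ->
  is_derive t 1 (H \o xi)
    (lie (drift S) H (xi t) + \sum_(j < m) lie (ctrl S j) H (xi t) * v j 0).
Proof.
move=> dH [/derivable1_diffP dxi xiE].
apply: DeriveDef; first exact/derivable1_diffP/differentiable_comp.
rewrite deriveE; last exact: differentiable_comp.
rewrite diff_comp//= -[X in 'd H _ X](deriveE _ dxi) xiE /dynamics linearD.
rewrite linear_sum/= /lie !deriveE//; congr (_ + _); apply: eq_bigr => j _.
by rewrite linearZ/= deriveE// mulrC.
Qed.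

End LieDerivatives.

(** * Integrator chains, smoothness and channel derivatives in the prolonged system *)

Section Prolonged.
Context {R : realType} {n p : nat}.
Variables (S : @affine_system R n p) (h : 'cV[R]_n -> 'cV[R]_p).
Variables (ell r : 'I_p -> nat).
Local Notation P := (prolongation S ell).
Local Notation state := 'cV[R]_(pdim n ell).

(** Takes the state as last argument so that it can carry the structure of a linear map. *)
Definition chain_coord k s (x : state) : R := chain x k s.

Fact chain_coord_is_linear k s : linear (chain_coord k s).
Proof.
move=> a x y; rewrite /chain_coord /chain.
case: insubP => [j _ _|_]; last by rewrite scaler0 addr0.
by rewrite !mxE.
Qed.
HB.instance Definition _ k s :=
  GRing.isLinear.Build R state R _ (chain_coord k s)
    (@chain_coord_is_linear k s).

Lemma chain_col_mx (a : 'cV[R]_n) (b : 'I_(\sum_k ell k) -> R) k s :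
  chain (col_mx a (\col_i b i) : state) k s =
  if insub s is Some j then b (tagnat.Rank k (j : 'I_(ell k))) else 0.
Proof. by rewrite /chain; case: insub => // j; rewrite col_mxKd mxE. Qed.

Lemma chain_drift x k s : (s < ell k)%N ->
  chain (drift P x) k s = chain x k s.+1.
Proof.
by move=> sk; rewrite chain_col_mx insubT tagnat.Rank2K/= tagnat.Rank1K.
Qed.

Lemma chain_ctrl x j k s : (s < ell k)%N ->
  chain (ctrl P j x) k s = ((k == j) && (s.+1 == ell k))%:R.
Proof.
move=> sk; rewrite chain_col_mx insubT tagnat.Rank2K/= tagnat.Rank1K.
by case: eqVneq => [->|].
Qed.

Lemma derive_chain_coord k s (x w : state) :
  'D_w (chain_coord k s) x = chain w k s.
Proof.
rewrite deriveE; last exact/linear_differentiable/linear_cV_continuous.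
by rewrite diff_lin//; exact: linear_cV_continuous.
Qed.

(** The bound is not strict: at [s = ell k] the default value 0 of [chain] applies, since the drift
    does not act on the last integrator. This is the zero block of [qvec]. *)
Lemma lie_iter_chain k s : (s <= ell k)%N ->
  lie_iter (drift P) s (chain_coord k 0) = chain_coord k s.
Proof.
elim: s => [//|s IHs] sk; rewrite /lie_iter iterS -/(lie_iter _ _ _).
rewrite IHs; last exact: ltnW.
by apply: funext => x; rewrite /lie derive_chain_coord chain_drift.
Qed.

Lemma usubmx_continuous m1 m2 :
  continuous (usubmx : 'cV[R]_(m1 + m2) -> 'cV[R]_m1).
Proof. exact: (@linear_cV_continuous R (m1 + m2) _ (@usubmx R m1 m2 1)). Qed.

Lemma open_prolongation : open (sdom S) -> open (sdom P).
Proof.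
move=> oS.
apply: (@open_comp _ _ (usubmx : 'cV[R]_(n + \sum_k ell k) -> 'cV[R]_n)) => //.
by move=> x _; exact: usubmx_continuous.
Qed.

Lemma smooth_on_usubmx (H : 'cV[R]_n -> R) : open (sdom S) ->
  smooth_on (sdom S) H -> smooth_on (sdom P) (fun x : state => H (usubmx x)).
Proof.
move=> oS H_smooth k.
apply: (@Ck_on_precomp_linear R _ _ _ (@usubmx R n (\sum_k ell k) 1)) => //.
exact: usubmx_continuous.
Qed.

Lemma smooth_on_coord m (G : 'cV[R]_n -> 'cV[R]_m) i : open (sdom S) ->
  smooth_on (sdom S) G -> smooth_on (sdom S) (cV_coord i \o G).
Proof.
move=> oS G_smooth k; apply: Ck_on_postcomp_linear => //.
exact: linear_cV_continuous.
Qed.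

Lemma smooth_on_chain k s : open (sdom S) ->
  smooth_on (sdom P) (chain_coord k s).
Proof.
move=> oS d; apply: Ck_on_linear; first exact: open_prolongation.
exact: linear_cV_continuous.
Qed.

Lemma smooth_on_drift i : smooth_system S ->
  smooth_on (sdom P) (cV_coord i \o drift P).
Proof.
move=> [oS drift_smooth ctrl_smooth] d.
have oP := open_prolongation oS.
have [j ->|j ->] := @split_ordP n (\sum_k ell k) i.
  apply: (@eq_Ck_on _ _ _ _ oP _
    ((fun x : state => (cV_coord j \o drift S) (usubmx x)) +
     \sum_(k < p) (chain_coord k 0) *
       (fun x : state => (cV_coord j \o ctrl S k) (usubmx x)))).
    move=> x _; rewrite /= /cV_coord col_mxEu !mxE !fctE fct_sumE summxE.
    by congr (_ + _); apply: eq_bigr => k _; rewrite mxE.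
  apply: Ck_onD => //.
    by apply: smooth_on_usubmx => //; exact: smooth_on_coord.
  apply: Ck_on_sum => // k; apply: Ck_onM => //; first exact: smooth_on_chain.
  by apply: smooth_on_usubmx => //; exact: smooth_on_coord.
apply: (@eq_Ck_on _ _ _ _ oP _
    (chain_coord (tagnat.sig1 j) (tagnat.sig2 j).+1)).
  by move=> x _; rewrite /= /cV_coord col_mxEd mxE.
exact: smooth_on_chain.
Qed.

Lemma smooth_on_channel b : smooth_system S -> smooth_on (sdom S) h ->
  smooth_on (sdom P) (Defs.omap (all_channels h ell) b).
Proof.
move=> [oS _ _] h_smooth; rewrite /all_channels/=.
case: fintype.split => k; last exact: smooth_on_chain.
apply: (smooth_on_usubmx (H := cV_coord k \o h)) => //.
exact: smooth_on_coord.
Qed.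

Lemma smooth_on_lie_channel b s : smooth_system S -> smooth_on (sdom S) h ->
  smooth_on (sdom P) (lie_iter (drift P) s (Defs.omap (all_channels h ell) b)).
Proof.
move=> S_smooth h_smooth; have [oS _ _] := S_smooth.
apply: smooth_on_lie_iter; first exact: open_prolongation.
  by move=> i; exact: smooth_on_drift.
exact: smooth_on_channel.
Qed.

(** [selected_degree] is this function composed with [channel]: the degree belongs to the channel
    and not to the selection. *)
Definition channel_degree (b : 'I_(p + p)) : nat :=
  match fintype.split b with inl k => r k | inr k => ell k end.

(** The identity block of [Dmx] expresses that the derivative of order [ell k] of u_k is v_k; for
    [ell k = 0] it comes from the feedthrough. *)
Lemma Dmx_channel b j (x : state) :
  Dmx S h r x b j = input_coef P (all_channels h ell) (channel_degree b) b j x.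
Proof.
rewrite /Dmx /channel_degree -[b in LHS]splitK /input_coef /all_channels /=.
case: fintype.split => k; first by rewrite /unsplit col_mxEu mxE /input_coef.
rewrite /unsplit col_mxEd mxE.
case ellk : (ell k) => [|d] /=; first by rewrite eq_sym.
have -> : (fun x : state => chain x k 0) = chain_coord k 0 by [].
rewrite lie_iter_chain ?ellk// /lie derive_chain_coord chain_ctrl ?ellk//.
by rewrite eqxx andbT.
Qed.

Lemma qvec_channel b d (x : state) : channel_degree b = d.+1 ->
  qvec S h r x b 0 =
    lie_iter (drift P) d.+1 (Defs.omap (all_channels h ell) b) x.
Proof.
move=> deg; rewrite /qvec -[b in LHS]splitK /all_channels /=.
move: deg; rewrite /channel_degree.
case: fintype.split => k.
  by rewrite /unsplit col_mxEu mxE => ->.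
rewrite /unsplit col_mxEd mxE => ellk.
have -> : (fun x : state => chain x k 0) = chain_coord k 0 by [].
rewrite lie_iter_chain ?ellk// /lie derive_chain_coord chain_drift ?ellk//.
by rewrite /chain insubF// ellk ltnn.
Qed.

End Prolonged.

(** * Positions of the channels in a selection *)

Section Channels.
Context {p : nat}.
Implicit Types A O : {set 'I_p}.

(** Equal cardinals make the list of selected channels exactly [p] long, so each position in it is
    an element of ['I_p]. *)
Lemma channel_exists A O b : #|A| = #|O| ->
  b \in [seq lshift p k | k <- enum (~: O)%SET] ++
        [seq rshift p k | k <- enum A] ->
  exists a, channel A O a = b.
Proof.
move=> AO bs; set s := _ ++ _ in bs.
have ss : size s = p.
  by rewrite size_cat !size_map -!cardE AO addnC cardsC card_ord.
have bp : (index b s < p)%N by rewrite -[X in (_ < X)%N]ss index_mem.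
by exists (Ordinal bp); rewrite /channel -/s nth_index.
Qed.

Lemma channel_y_exists A O k : #|A| = #|O| -> k \notin O ->
  exists a, channel A O a = lshift p k.
Proof.
move=> AO kO; apply: channel_exists => //.
by rewrite mem_cat map_f// mem_enum inE.
Qed.

Lemma channel_u_exists A O k : #|A| = #|O| -> k \in A ->
  exists a, channel A O a = rshift p k.
Proof.
move=> AO kA; apply: channel_exists => //.
by rewrite mem_cat orbC map_f// mem_enum.
Qed.

End Channels.

(** * The closed loop seen from a single channel *)

Section Regulation.
Context {R : realType} {n p : nat}.
Variables (S : @affine_system R n p) (h : 'cV[R]_n -> 'cV[R]_p).
Variables (ell r : 'I_p -> nat) (c : @controller_data R p).
Variables (xi : R -> 'cV[R]_(pdim n ell)) (v : R -> 'cV[R]_p).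
Local Notation P := (prolongation S ell).
Local Notation channels := (all_channels h ell).
Local Notation degree := (channel_degree ell r).

Lemma Gamma_row A O m (M : 'M[R]_(p + p, m)) a j :
  (Gamma A O *m M) a j = M (channel A O a) j.
Proof.
rewrite mxE (bigD1 (channel A O a))//= mxE eqxx mul1r big1 ?addr0// => b.
by rewrite mxE => /negPf ->; rewrite mul0r.
Qed.

(** Hence on the validity set the matrix inverted by the control law is indeed invertible. *)
Lemma Gamma_Dmx A O x : Gamma A O *m Dmx S h r x =
  decoupling P (selected_output h ell A O) (selected_degree ell r A O) x.
Proof. by apply/matrixP => a j; rewrite Gamma_row Dmx_channel mxE. Qed.

(** Forgets which selection is active and keeps only that it contains [b], so the times before and
    after the switch are treated alike. *)
Definition regulated_at (b : 'I_(p + p)) (t : R) : Prop :=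
  exists A O a, [/\ channel A O a = b,
    selected_validity_set S h ell r A O (xi t) &
    regulates S h r c xi v A O t].

Lemma regulated_sdom b t : regulated_at b t -> sdom P (xi t).
Proof. by move=> [A [B [a [_ [xiP _ _] _]]]]. Qed.

(** Multiplying the law by [Gamma A O *m Dmx] and reading the row of [b] leaves an equation without
    any trace of the selection. *)
Lemma regulated_row b t : regulated_at b t ->
  \sum_(j < p) Dmx S h r (xi t) b j * v t j 0 =
  - qvec S h r (xi t) b 0 + wvec h r c xi v t b 0.
Proof.
move=> [A [B [a [ <- [_ _ A_unit] vE]]]].
have : (Gamma A B *m Dmx S h r (xi t)) *m v t =
    - (Gamma A B *m qvec S h r (xi t)) + Gamma A B *m wvec h r c xi v t.
  by rewrite vE mulKVmx// Gamma_Dmx.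
move/matrixP => /(_ a 0); rewrite -mulmxA Gamma_row mxE => ->.
by rewrite mxE [X in X + _]mxE !Gamma_row.
Qed.

Lemma regulated_coef0 b t s j : regulated_at b t -> (s < degree b)%N ->
  input_coef P channels s b j (xi t) = 0.
Proof.
move=> [A [B [a [ <- [_ coef0 _] _]]]] sb.
exact: nbhs_singleton (coef0 a j s sb).
Qed.

(** An output y_k has no feedthrough, so degree 0 would give a zero row in an invertible matrix. *)
Lemma regulated_y_degree_gt0 k t : regulated_at (lshift p k) t -> (0 < r k)%N.
Proof.
move=> [A [B [a [ab [_ _ A_unit] _]]]]; rewrite lt0n; apply/eqP => rk0.
have row0 (j : 'I_p) : decoupling P (selected_output h ell A B)
    (selected_degree ell r A B) (xi t) a j = 0.
  rewrite mxE /selected_degree ab (unsplitK (inl k)) rk0 /= ab.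
  by rewrite (unsplitK (inl k)).
move: A_unit => /mulmxV/matrixP/(_ a a).
rewrite !mxE eqxx big1 => [/esym/eqP|j _]; first by rewrite oner_eq0.
by rewrite row0 mul0r.
Qed.

(** Output channels and input channels with integrators are handled together; the hypothesis on
    [wvec] records the reference and gains of the channel. *)
Lemma channel_lti (S_smooth : smooth_system S) (h_smooth : smooth_on (sdom S) h)
    (J : set R) (ts : R) b d (ref : R -> R) (gain : nat -> R) :
  open J -> J ts ->
  (forall t, J t -> {for t, continuous xi}) ->
  (forall t, J t -> t != ts -> is_derive t 1 xi (dynamics P (xi t) (v t))) ->
  degree b = d.+1 -> Ck_on d.+1 J ref ->
  (forall t, J t -> regulated_at b t) ->
  (forall t, wvec h r c xi v t b 0 = derive1n d.+1 ref t +
     \sum_(s < d.+1) gain s *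
        derive1n s (fun u => ref u - Defs.omap channels b (xi u)) t) ->
  lti_solution d.+1 gain J (fun t => ref t - Defs.omap channels b (xi t)).
Proof.
move=> J_open J_ts xi_cont xi_ode bd ref_Ck reg wE.
pose H s := lie_iter (drift P) s (Defs.omap channels b).
have H_smooth s : smooth_on (sdom P) (H s) by exact: smooth_on_lie_channel.
have H_diff s t : J t -> differentiable (H s) (xi t).
  by move=> Jt; have [+ _] := H_smooth s 1%N; apply; exact/regulated_sdom/reg.
apply: (@lti_solution_switch R d gain J ts ref (fun s t => H s (xi t))) => //.
- move=> s t _ Jt; apply: continuous_comp; first exact: xi_cont.
  exact/differentiable_continuous/H_diff.
- move=> s t sd Jt tts.
  have := is_derive_trajectory (H_diff s t Jt) (xi_ode t Jt tts).
  rewrite big1 ?addr0 // => j _; apply/eqP; rewrite mulf_eq0; apply/orP; left.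
  apply/eqP/(regulated_coef0 (s := s.+1) j (reg t Jt)).
  by rewrite bd.
- move=> t Jt tts; rewrite -wE.
  (* The row of [b] in the law: its drift and input terms add up to the derivative of [H d] along
     the trajectory. *)
  have -> : wvec h r c xi v t b 0 = lie (drift P) (H d) (xi t) +
      \sum_(j < p) lie (ctrl P j) (H d) (xi t) * v t j 0.
    rewrite (eq_bigr (fun j => Dmx S h r (xi t) b j * v t j 0)) => [|j _].
      by rewrite (regulated_row (reg t Jt)) (qvec_channel S h _ bd) addNKr.
    by rewrite Dmx_channel bd.
  exact: is_derive_trajectory (H_diff d t Jt) (xi_ode t Jt tts).
Qed.

End Regulation.

Theorem lemma1 (R : realType) (n p : nat)
  (S : @affine_system R n p) (h : 'cV[R]_n -> 'cV[R]_p)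
  (S_smooth : smooth_system S) (h_smooth : smooth_on (sdom S) h)
  (y_flat : flat_output S (state_output p h))
  (ell r : 'I_p -> nat)
  (y_flat_ell : flat_with (prolongation S ell) (prolonged_y h ell) r)
  (Ai Oi Aj Oj : {set 'I_p})
  (realizable_i : realizable_family S h ell (Ai, Oi))
  (realizable_j : realizable_family S h ell (Aj, Oj))
  (compat : compatible (prolongation S ell)
     (selected_output h ell Ai Oi) (selected_output h ell Aj Oj)
     (selected_degree ell r Ai Oi) (selected_degree ell r Aj Oj))
  (J : set R) (J_open : open J) (J_itv : is_interval J)
  (ts : R) (J_ts : J ts)
  (c : @controller_data R p) (c_adm : admissible_controller ell r c J)
  (xi : R -> 'cV[R]_(pdim n ell)) (v : R -> 'cV[R]_p)
  (xi_cont : forall t, J t -> {for t, continuous xi})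
  (xi_ode : forall t, J t -> t != ts ->
     is_derive t 1 xi (dynamics (prolongation S ell) (xi t) (v t)))
  (regulates_i : forall t, J t -> t < ts ->
     regulates S h r c xi v Ai Oi t)
  (regulates_j : forall t, J t -> ts <= t ->
     regulates S h r c xi v Aj Oj t)
  (valid_i : forall t, J t -> t < ts ->
     selected_validity_set S h ell r Ai Oi (xi t))
  (valid_j : forall t, J t -> ts <= t ->
     selected_validity_set S h ell r Aj Oj (xi t))
  (valid_ts : selected_validity_set S h ell r Ai Oi (xi ts)
           /\ selected_validity_set S h ell r Aj Oj (xi ts)) :
  (forall k : 'I_p, k \notin Oi -> k \notin Oj ->
     exponentially_stable (r k) (ygain c k) /\
     lti_solution (r k) (ygain c k) J (yerror h c xi k)) /\
  (forall k : 'I_p, k \in Ai -> k \in Aj ->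
     exponentially_stable (ell k) (ugain c k) /\
     lti_solution (ell k) (ugain c k) J (uerror c xi v k)).
Proof.
have [cardi _] := realizable_i; have [cardj _] := realizable_j.
have [yref_Ck uref_Ck y_Hurwitz u_Hurwitz] := c_adm.
(* A shared channel is regulated at every time of [J], by whichever selection is active. *)
have reg b :
    (exists a, channel Ai Oi a = b) -> (exists a, channel Aj Oj a = b) ->
    forall t, J t -> regulated_at S h r c xi v b t.
  move=> [ai bi] [aj bj] t Jt; have [tts|tst] := ltP t ts.
    by exists Ai, Oi, ai; split => //; [exact: valid_i|exact: regulates_i].
  by exists Aj, Oj, aj; split => //; [exact: valid_j|exact: regulates_j].
split=> k kI kJ; split; try exact: Hurwitz_exponentially_stable.
  have {}reg := reg _ (channel_y_exists cardi kI) (channel_y_exists cardj kJ).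
  case rk : (r k) (regulated_y_degree_gt0 (reg ts J_ts)) => [//|d] _.
  have yE : (fun t => yref c k t -
      Defs.omap (all_channels h ell) (lshift p k) (xi t)) = yerror h c xi k.
    by apply: funext => t; rewrite /= (unsplitK (inl k)).
  rewrite -yE; apply: (channel_lti S_smooth h_smooth J_open J_ts xi_cont xi_ode
    (r := r) (b := lshift p k) (c := c)) => //.
  - by rewrite /channel_degree (unsplitK (inl k)).
  - by rewrite -rk.
  - by move=> t; rewrite yE /wvec col_mxEu mxE rk.
have {}reg := reg _ (channel_u_exists cardi kI) (channel_u_exists cardj kJ).
case ellk : (ell k) => [|d].
  (* Without integrator u_k is v_k, and the row of the law reads v_k = [uref c k t]: the error is
     zero at each time. *)
  move=> t Jt; split=> //; rewrite big_ord0 addr0 /=.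
  have := regulated_row (reg t Jt).
  rewrite /Dmx /qvec /wvec !col_mxEd !mxE ellk big_ord0 addr0 oppr0 add0r.
  rewrite (bigD1 k)//= col_mxEd mxE eqxx mul1r big1 ?addr0 => [vk|j].
    by rewrite /uerror /usignal ellk/= vk subrr.
  by rewrite eq_sym => /negPf kj; rewrite col_mxEd mxE kj mul0r.
have uE : (fun t => uref c k t -
    Defs.omap (all_channels h ell) (rshift p k) (xi t)) = uerror c xi v k.
  by apply: funext => t; rewrite /uerror /usignal ellk /= (unsplitK (inr k)).
rewrite -uE; apply: (channel_lti S_smooth h_smooth J_open J_ts xi_cont xi_ode
  (r := r) (b := rshift p k) (c := c)) => //.
- by rewrite /channel_degree (unsplitK (inr k)).
- by rewrite -ellk.
- by move=> t; rewrite uE /wvec col_mxEd mxE ellk.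
Qed.
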